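(* Let $K$ be a field and let $\mathbb{X}=\{p_1,\dots,p_s\}\subseteq\mathbb{P}^n_K$ be a set of $s$ distinct $K$-rational points, none on the hyperplane $X_0=0$. Then $\mathrm{HP}_{\delta_{\mathbb{X}}}(z)=s$ and $\mathrm{ri}(\delta_{\mathbb{X}})=2r_{\mathbb{X}}$, where $\delta_{\mathbb{X}}$ is the Dedekind different of $\mathbb{X}$.
   Context: $P=K[X_0,\dots,X_n]$ has the standard grading, $I_{\mathbb{X}}\subseteq P$ is the homogeneous vanishing ideal of $\mathbb{X}$ (with reduced structure), $R=P/I_{\mathbb{X}}$, and $x_0$ is the residue class of $X_0$, a non-zerodivisor of $R$. For a finitely generated graded $R$-module $M$, $\mathrm{HF}_M(i)=\dim_KM_i$, $\mathrm{HP}_M$ is its Hilbert polynomial (the polynomial agreeing with $\mathrm{HF}_M(i)$ for $i\gg0$), and its regularity index is $\mathrm{ri}(M)=\min\{i\in\mathbb{Z}\mid\mathrm{HF}_M(j)=\mathrm{HP}_M(j)\text{ for all }j\ge i\}$. $r_{\mathbb{X}}=\mathrm{ri}(R)$, i.e. the least integer such that $\dim_KR_i=s$ for all $i\ge r_{\mathbb{X}}$. $Q^h(R)=R_{x_0}\cong\prod_{j=1}^sK[T_j,T_j^{-1}]$, $\deg T_j=1$, with $f\in R_i$ mapping to $(f(p_1)T_1^i,\dots,f(p_s)T_s^i)$, where points are written $p_j=(1:p_{j1}:\dots:p_{jn})$ and $f(p_j)$ is the value of a representative at $(1,p_{j1},\dots,p_{jn})$. $L_0=K[x_0,x_0^{-1}]$,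 and $\sigma:Q^h(R)\to L_0$, $\sigma(h_1(T_1),\dots,h_s(T_s))=\sum_jh_j(x_0)$, is the canonical trace map, for which $\underline{\mathrm{Hom}}_{L_0}(Q^h(R),L_0)=Q^h(R)\cdot\sigma$. The Dedekind complementary module $\mathfrak{C}_{\mathbb{X}}\subseteq Q^h(R)$ is the image of the injection $\underline{\mathrm{Hom}}_{K[x_0]}(R,K[x_0])\to\underline{\mathrm{Hom}}_{L_0}(Q^h(R),L_0)=Q^h(R)\sigma\cong Q^h(R)$, $\varphi\mapsto\varphi\otimes\mathrm{id}_{L_0}$ (the last isomorphism sending $g\sigma$ to $g$). The Dedekind different is $\delta_{\mathbb{X}}=\{f\in Q^h(R)\mid f\cdot\mathfrak{C}_{\mathbb{X}}\subseteq R\}$, a homogeneous ideal of $R$. *)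

(* Defs.v *)
From HB Require Import structures.
From mathcomp Require Import all_boot all_order all_algebra.
From mathcomp Require Import generic_quotient ring_quotient fraction.
From mathcomp Require Import boolp.
From mathcomp Require Import mpoly.

Set Implicit Arguments.
Unset Strict Implicit.
Unset Printing Implicit Defensive.

Import Order.TTheory GRing.Theory Num.Theory.

Local Open Scope ring_scope.
Local Open Scope quotient_scope.

(** Laurent polynomials: [K[T, T^-1]] as the subring of [K(T)] of all
    fractions [p / T^k]. *)

Section LaurentPred.
Variable K : fieldType.

Definition laurent_pred (f : {fraction {poly K}}) : bool :=
  `[< exists (k : nat) (p : {poly K}),
        f * FracField.tofrac 'X ^+ k = FracField.tofrac p >].

Lemma laurent_subring : subring_closed laurent_pred.
Proof.
split=> [|f g|f g]; first by apply/asboolP; exists 0%N, 1; rewrite mulr1 rmorph1.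
- move=> /asboolP [k [p fp]] /asboolP [l [q gq]]; apply/asboolP.
  exists (k + l)%N, (p * 'X^l - q * 'X^k).
  rewrite rmorphB !rmorphM !rmorphXn /= -fp -gq exprD mulrBl.
  by congr (_ - _); last rewrite (mulrC (_ ^+ k)); rewrite mulrA.
- move=> /asboolP [k [p fp]] /asboolP [l [q gq]]; apply/asboolP.
  by exists (k + l)%N, (p * q); rewrite rmorphM /= -fp -gq exprD mulrACA.
Qed.

HB.instance Definition _ :=
  GRing.isSubringClosed.Build {fraction {poly K}} laurent_pred laurent_subring.

Record laurent : predArgType :=
  Laurent { laurent_val : {fraction {poly K}}; _ : laurent_pred laurent_val }.

HB.instance Definition _ := [isSub for laurent_val].
HB.instance Definition _ := [Choice of laurent by <:].
HB.instance Definition _ := [SubChoice_isSubComNzRing of laurent by <:].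

End LaurentPred.

Section LaurentTheory.
Variable K : fieldType.

Lemma poly_laurent_subproof (p : {poly K}) :
  laurent_pred (FracField.tofrac p).
Proof. by apply/asboolP; exists 0%N, p; rewrite mulr1. Qed.

Definition poly_laurent (p : {poly K}) : laurent K :=
  Laurent (poly_laurent_subproof p).

Lemma poly_laurent_is_zmod_morphism : zmod_morphism poly_laurent.
Proof. by move=> p q; apply: val_inj; rewrite /= rmorphB. Qed.
Lemma poly_laurent_is_monoid_morphism : monoid_morphism poly_laurent.
Proof.
by split=> [|p q]; apply: val_inj; rewrite /= ?rmorph1 ?rmorphM.
Qed.
HB.instance Definition _ := GRing.isZmodMorphism.Build {poly K} (laurent K)
  poly_laurent poly_laurent_is_zmod_morphism.
HB.instance Definition _ := GRing.isMonoidMorphism.Build {poly K} (laurent K)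
  poly_laurent poly_laurent_is_monoid_morphism.

Lemma poly_laurent_inj : injective poly_laurent.
Proof.
by move=> p q /(congr1 val) /= /eqP; rewrite tofrac_eq => /eqP.
Qed.

Definition laurent_scale (c : K) (f : laurent K) : laurent K :=
  poly_laurent c%:P * f.

Lemma laurent_scaleA a b f :
  laurent_scale a (laurent_scale b f) = laurent_scale (a * b) f.
Proof. by rewrite /laurent_scale mulrA -rmorphM -polyCM. Qed.
Lemma laurent_scale1 : left_id 1 laurent_scale.
Proof. by move=> f; rewrite /laurent_scale rmorph1 mul1r. Qed.
Lemma laurent_scaleDr : right_distributive laurent_scale +%R.
Proof. by move=> c f g; rewrite /laurent_scale mulrDr. Qed.
Lemma laurent_scaleDl f : {morph laurent_scale^~ f : a b / a + b}.
Proof. by move=> a b; rewrite /laurent_scale polyCD rmorphD mulrDl. Qed.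
HB.instance Definition _ := GRing.Zmodule_isLmodule.Build K (laurent K)
  laurent_scaleA laurent_scale1 laurent_scaleDr laurent_scaleDl.

Lemma laurent_scaleAl (c : K) (f g : laurent K) : c *: (f * g) = c *: f * g.
Proof. exact: mulrA. Qed.
HB.instance Definition _ :=
  GRing.Lmodule_isLalgebra.Build K (laurent K) laurent_scaleAl.
HB.instance Definition _ := GRing.Lalgebra_isComAlgebra.Build K (laurent K).

Lemma laurent_X_subproof (i : int) :
  @laurent_pred K (FracField.tofrac 'X ^ i).
Proof.
have X0 : FracField.tofrac ('X : {poly K}) != 0 by rewrite tofrac_eq0 polyX_eq0.
apply/asboolP; case: i => i.
  by exists 0%N, 'X^i; rewrite mulr1 rmorphXn.
by exists i.+1, 1; rewrite NegzE -exprnN mulVf ?expf_neq0 // rmorph1.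
Qed.

Definition laurent_X (i : int) : laurent K := Laurent (laurent_X_subproof i).

Lemma laurent_XD i j : laurent_X (i + j) = laurent_X i * laurent_X j.
Proof.
apply: val_inj; rewrite /= expfzDr //.
by rewrite tofrac_eq0 polyX_eq0.
Qed.

Lemma laurent_X0 : laurent_X 0 = 1.
Proof. by apply: val_inj; rewrite /= expr0z. Qed.

Lemma laurent_Xn (k : nat) : laurent_X k = poly_laurent 'X^k.
Proof. by apply: val_inj; rewrite /= rmorphXn. Qed.

Lemma poly_laurentZ c p : poly_laurent (c *: p) = c *: poly_laurent p.
Proof. by rewrite -mul_polyC rmorphM. Qed.

Lemma laurentP (f : laurent K) :
  exists (k : nat) (p : {poly K}), f * laurent_X k = poly_laurent p.
Proof.
have /asboolP [k [p fp]] := valP f; exists k, p.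
by apply: val_inj; rewrite /= -fp.
Qed.

End LaurentTheory.

Section Hilbert.
Variables (K : fieldType) (V : lmodType K).

Definition has_dim (A : V -> Prop) (d : nat) : Prop :=
  exists b : 'I_d -> V,
    (forall c : 'I_d -> K, \sum_k c k *: b k = 0 -> forall k, c k = 0) /\
    (forall v, A v <-> exists c : 'I_d -> K, v = \sum_k c k *: b k).

(** [M i] is the homogeneous component of degree [i]. *)
Implicit Types M : int -> V -> Prop.

Definition is_hilbert_function M (HF : int -> nat) : Prop :=
  forall i, has_dim (M i) (HF i).

Definition is_hilbert_polynomial M (HP : {poly rat}) : Prop :=
  exists HF, is_hilbert_function M HF /\
    exists i0 : int, forall i, i0 <= i -> (HF i)%:R = HP.[i%:~R].

Definition is_regularity_index M (r : int) : Prop :=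
  exists HF HP, [/\ is_hilbert_function M HF, is_hilbert_polynomial M HP,
    forall j, r <= j -> (HF j)%:R = HP.[j%:~R] &
    forall i, (forall j, i <= j -> (HF j)%:R = HP.[j%:~R]) -> r <= i].

End Hilbert.

(** A point is given by arbitrary homogeneous coordinates; being distinct in
    projective space means having non-proportional coordinate vectors. *)
Record point_set (K : fieldType) (n s : nat) := PointSet {
  hcoord : 'I_s -> 'I_n.+1 -> K;
  hcoord0_neq0 : forall j, hcoord j ord0 != 0;
  hcoord_distinct : forall j k,
    (exists c : K, forall i, hcoord j i = c * hcoord k i) -> j = k;
  point_set_nonempty : (0 < s)%N
}.

Section Points.
Variables (K : fieldType) (n s : nat) (X : point_set K n s).

Local Notation P := {mpoly K[n.+1]}.

(** The representative [(1 : p_j1 : ... : p_jn)] of the [j]-th point. *)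
Definition ncoord (j : 'I_s) (i : 'I_n.+1) : K := hcoord X j i / hcoord X j ord0.

Definition vanishing_form (h : P) : Prop :=
  (exists d : nat, h \is d.-homog) /\ forall j, h.@[hcoord X j] = 0.

(** The ideal generated by the homogeneous polynomials vanishing on [X]. *)
Definition vanishing_ideal (f : P) : bool :=
  `[< exists (m : nat) (g h : 'I_m -> P),
        (forall k, vanishing_form (h k)) /\ f = \sum_k g k * h k >].

(** Restriction of a polynomial to the line through [x]: this is
    [\sum_d f_d(x) 'X^d], where [f_d] is the component of degree [d] of [f]. *)
Definition restr_line (x : 'I_n.+1 -> K) (f : P) : {poly K} :=
  mmap (@polyC K) (fun i => x i *: 'X) f.

HB.instance Definition _ x := GRing.RMorphism.copy (restr_line x)
  (mmap (@polyC K) (fun i => x i *: 'X)).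

Lemma restr_lineE x f :
  restr_line x f = \sum_(m <- msupp f) (f@_m * mmap1 x m) *: 'X^(mdeg m).
Proof.
apply: eq_bigr => m _; rewrite -scalerA -mul_polyC; congr (_ * _).
rewrite /mmap1; under eq_bigr do rewrite exprZn.
rewrite scaler_prod; congr (_ *: _).
by rewrite prodrXr mdegE.
Qed.

Lemma restr_line_homog x f d : f \is d.-homog ->
  restr_line x f = f.@[x] *: 'X^d.
Proof.
move=> /dhomogP fd; rewrite restr_lineE /meval /mmap scaler_suml.
by apply: eq_big_seq => m /fd ->.
Qed.

Lemma coef_restr_line x f d : (restr_line x f)`_d = (pihomog mdeg d f).@[x].
Proof.
rewrite {1}(@pihomog_partitionE _ _ mdeg (maxn d.+1 (msize f)) f) ?leq_maxr //.
rewrite rmorph_sum /= coef_sum.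
have ltd : (d < maxn d.+1 (msize f))%N by rewrite leq_maxl.
rewrite (bigD1 (Ordinal ltd)) //= (restr_line_homog _ (pihomogP _ _ _)).
rewrite coefZ coefXn eqxx mulr1 big1 ?addr0 // => e ne.
rewrite (restr_line_homog _ (pihomogP _ _ _)) coefZ coefXn.
case: eqP => [de|]; last by rewrite mulr0.
by case/eqP: ne; apply: val_inj.
Qed.

Lemma vanishing_idealE f :
  (f \in vanishing_ideal) = [forall j, restr_line (hcoord X j) f == 0].
Proof.
apply/asboolP/forallP => [[m [g [h [hv ->]]]] j|f0].
  rewrite rmorph_sum big1 //= => k _; have [[d hd] h0] := hv k.
  by rewrite rmorphM /= (restr_line_homog _ hd) h0 scale0r mulr0.
exists (msize f), (fun=> 1), (fun d => pihomog mdeg d f); split.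
  move=> d; split; first by exists d; apply: pihomogP.
  by move=> j; rewrite -coef_restr_line (eqP (f0 j)) coef0.
by under eq_bigr do rewrite mul1r; apply: pihomog_partitionE.
Qed.

Lemma vanishing_idealP f :
  f \in vanishing_ideal <->
  forall d j, (pihomog mdeg d f).@[hcoord X j] = 0.
Proof.
rewrite vanishing_idealE; split=> [/forallP f0 d j|f0].
  by rewrite -coef_restr_line (eqP (f0 j)) coef0.
by apply/forallP => j; apply/eqP/polyP => d; rewrite coef_restr_line coef0.
Qed.

Lemma vanishing_ideal_closed : idealr_closed vanishing_ideal.
Proof.
split=> [||a u v].
- by rewrite vanishing_idealE; apply/forallP => j; rewrite rmorph0.
- rewrite vanishing_idealE; apply/forallPn.
  by exists (Ordinal (point_set_nonempty X)); rewrite rmorph1 oner_neq0.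
- rewrite !vanishing_idealE => /forallP u0 /forallP v0; apply/forallP => j.
  by rewrite rmorphD rmorphM /= (eqP (u0 j)) (eqP (v0 j)) mulr0 addr0.
Qed.

HB.instance Definition _ := isIdealr.Build P vanishing_ideal vanishing_ideal_closed.

Definition vanishing_idealr : idealr P := vanishing_ideal.

Definition coord_ring : Type := {ideal_quot vanishing_idealr}.
HB.instance Definition _ := GRing.ComNzRing.on coord_ring.

Definition to_coord (f : P) : coord_ring := \pi_({ideal_quot vanishing_idealr}) f.

Lemma to_coord_is_zmod_morphism : zmod_morphism to_coord.
Proof. by move=> f g; rewrite /to_coord rmorphB. Qed.
Lemma to_coord_is_monoid_morphism : monoid_morphism to_coord.
Proof. by split=> [|f g]; rewrite /to_coord ?rmorph1 ?rmorphM. Qed.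
HB.instance Definition _ := GRing.isZmodMorphism.Build P coord_ring
  to_coord to_coord_is_zmod_morphism.
HB.instance Definition _ := GRing.isMonoidMorphism.Build P coord_ring
  to_coord to_coord_is_monoid_morphism.

Definition coord_scale (c : K) (r : coord_ring) : coord_ring :=
  to_coord c%:MP * r.

Lemma coord_scaleA a b r :
  coord_scale a (coord_scale b r) = coord_scale (a * b) r.
Proof. by rewrite /coord_scale mulrA -rmorphM -mpolyCM. Qed.
Lemma coord_scale1 : left_id 1 coord_scale.
Proof. by move=> r; rewrite /coord_scale rmorph1 mul1r. Qed.
Lemma coord_scaleDr : right_distributive coord_scale +%R.
Proof. by move=> c r t; rewrite /coord_scale mulrDr. Qed.
Lemma coord_scaleDl r : {morph coord_scale^~ r : a b / a + b}.
Proof. by move=> a b; rewrite /coord_scale mpolyCD rmorphD mulrDl. Qed.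
HB.instance Definition _ := GRing.Zmodule_isLmodule.Build K coord_ring
  coord_scaleA coord_scale1 coord_scaleDr coord_scaleDl.

(** [R_i]; the condition on [f] forces [f = 0] when [i < 0]. *)
Definition coord_deg (i : int) (r : coord_ring) : Prop :=
  exists f : P, (forall m, m \in msupp f -> (mdeg m)%:Z = i) /\ r = to_coord f.

(** The structural map [K[x_0] -> R]. *)
Definition x0_poly (a : {poly K}) : coord_ring :=
  to_coord (horner_alg ('X_ord0 : P) a).

(** The homogeneous ring of quotients [Q^h(R) = R_{x_0}], realised as the product of
    the rings [K[T_j, T_j^-1]]; the lemmas
    [to_hquot_inj], [to_hquot_x0] and [hquot_localization] below show that
    [to_hquot] exhibits it as the localization of [R] at [x_0]. *)

Definition hquot : Type := {ffun 'I_s -> laurent K}.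
HB.instance Definition _ := GRing.PzRing.on hquot.
HB.instance Definition _ := GRing.Lmodule.on hquot.

(** [f] is sent to [\sum_i (f_i(p_1) T_1^i, ..., f_i(p_s) T_s^i)]. *)
Definition eval_hquot (f : P) : hquot :=
  [ffun j => mmap (GRing.in_alg (laurent K))
               (fun i => ncoord j i *: laurent_X K 1) f].

Definition to_hquot (r : coord_ring) : hquot :=
  eval_hquot (repr (r : {ideal_quot vanishing_idealr})).

(** [L_0 = K[x_0, x_0^-1]] acts on [Q^h(R)] through the diagonal. *)
Definition diag_hquot (l : laurent K) : hquot := [ffun=> l].

Definition hquot_deg (i : int) (q : hquot) : Prop :=
  exists c : 'I_s -> K, forall j, q j = c j *: laurent_X K i.

(** [sigma : Q^h(R) -> L_0]; each [T_j] is replaced by [x_0]. *)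
Definition trace_hquot (q : hquot) : laurent K := \sum_j q j.

Definition x0_linear (phi : coord_ring -> {poly K}) : Prop :=
  forall a r t, phi (x0_poly a * r + t) = a * phi r + phi t.

Definition homog_of_degree (d : int) (phi : coord_ring -> {poly K}) : Prop :=
  forall i r, coord_deg i r -> forall k : nat, (phi r)`_k != 0 -> k%:Z = i + d.

(** The graded Hom module: finite sums of homogeneous [K[x_0]]-linear maps
    from [R] to [K[x_0]]. *)
Definition graded_hom (phi : coord_ring -> {poly K}) : Prop :=
  exists (m : nat) (d : 'I_m -> int) (phis : 'I_m -> coord_ring -> {poly K}),
    [/\ forall k, x0_linear (phis k),
        forall k, homog_of_degree (d k) (phis k) &
        forall r, phi r = \sum_k phis k r].

(** [psi = phi \otimes id_{L_0}], where [r \otimes l] is identified with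
    [r l] under the isomorphism of [R \otimes_{K[x_0]} L_0] with [Q^h(R)]. *)
Definition is_base_change (phi : coord_ring -> {poly K})
    (psi : hquot -> laurent K) : Prop :=
  (forall q q', psi (q + q') = psi q + psi q') /\
  (forall r l, psi (to_hquot r * diag_hquot l) = poly_laurent (phi r) * l).

(** [g] belongs to the complementary module iff [g sigma] is the base change
    of some [phi]. *)
Definition complementary (g : hquot) : Prop :=
  exists2 phi, graded_hom phi &
    is_base_change phi (fun q => trace_hquot (g * q)).

Definition different (f : hquot) : Prop :=
  forall g, complementary g -> exists r, f * g = to_hquot r.

Definition different_deg (i : int) (f : hquot) : Prop :=
  different f /\ hquot_deg i f.

Lemma eval_hquotE f j :
  eval_hquot f j = poly_laurent (restr_line (ncoord j) f).
Proof.
rewrite ffunE /restr_line /mmap rmorph_sum; apply: eq_bigr => m _.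
rewrite rmorphM /=; congr (_ * _); first exact: mulr1.
rewrite /mmap1 rmorph_prod; apply: eq_bigr => i _.
by rewrite rmorphXn /= poly_laurentZ laurent_Xn expr1.
Qed.

Lemma eval_hquot_is_zmod_morphism : zmod_morphism eval_hquot.
Proof. by move=> f g; apply/ffunP => j; rewrite !ffunE rmorphB. Qed.
Lemma eval_hquot_is_monoid_morphism : monoid_morphism eval_hquot.
Proof.
by split=> [|f g]; apply/ffunP => j; rewrite !ffunE ?rmorph1 ?rmorphM.
Qed.
HB.instance Definition _ := GRing.isZmodMorphism.Build P hquot
  eval_hquot eval_hquot_is_zmod_morphism.
HB.instance Definition _ := GRing.isMonoidMorphism.Build P hquot
  eval_hquot eval_hquot_is_monoid_morphism.

Lemma eval_hquot_eq0 f : (eval_hquot f == 0) = (f \in vanishing_ideal).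
Proof.
have sc j d : (restr_line (ncoord j) f)`_d =
    (hcoord X j ord0)^-1 ^+ d * (restr_line (hcoord X j) f)`_d.
  rewrite !restr_lineE !coef_sum mulr_sumr; apply: eq_bigr => m _.
  rewrite !coefZ coefXn; case: eqP => [->|]; last by rewrite !mulr0.
  rewrite !mulr1 mulrCA; congr (_ * _).
  rewrite mdegE -prodrXr -big_split /=; apply: eq_bigr => i _.
  by rewrite -exprMn mulrC.
rewrite vanishing_idealE; apply/eqP/forallP => [f0 j|f0].
  apply/eqP/polyP => d; rewrite coef0.
  have /polyP/(_ d) : restr_line (ncoord j) f = 0.
    by apply: poly_laurent_inj; rewrite -eval_hquotE f0 ffunE rmorph0.
  rewrite coef0 sc => /eqP; rewrite mulf_eq0 expf_eq0 invr_eq0.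
  by rewrite (negbTE (hcoord0_neq0 X j)) andbF => /eqP.
apply/ffunP => j; rewrite eval_hquotE [RHS]ffunE.
suff -> : restr_line (ncoord j) f = 0 by rewrite rmorph0.
by apply/polyP => d; rewrite sc (eqP (f0 j)) coef0 mulr0.
Qed.

Lemma to_hquotE f : to_hquot (to_coord f) = eval_hquot f.
Proof.
apply/eqP; rewrite -subr_eq0 -rmorphB eval_hquot_eq0 Quotient.idealrBE.
by rewrite reprK.
Qed.

Lemma to_coord_surj r : exists f, r = to_coord f.
Proof.
exists (repr (r : {ideal_quot vanishing_idealr})).
by rewrite /to_coord reprK.
Qed.

Lemma to_hquot_is_zmod_morphism : zmod_morphism to_hquot.
Proof.
move=> r t; have [f ->] := to_coord_surj r; have [g ->] := to_coord_surj t.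
by rewrite -rmorphB !to_hquotE rmorphB.
Qed.
Lemma to_hquot_is_monoid_morphism : monoid_morphism to_hquot.
Proof.
split=> [|r t]; first by rewrite -(rmorph1 to_coord) to_hquotE rmorph1.
have [f ->] := to_coord_surj r; have [g ->] := to_coord_surj t.
by rewrite -rmorphM !to_hquotE rmorphM.
Qed.
HB.instance Definition _ := GRing.isZmodMorphism.Build coord_ring hquot
  to_hquot to_hquot_is_zmod_morphism.
HB.instance Definition _ := GRing.isMonoidMorphism.Build coord_ring hquot
  to_hquot to_hquot_is_monoid_morphism.

Lemma to_hquot_inj : injective to_hquot.
Proof.
move=> r t; have [f ->] := to_coord_surj r; have [g ->] := to_coord_surj t.
rewrite !to_hquotE => /eqP; rewrite -subr_eq0 -rmorphB eval_hquot_eq0.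
by rewrite Quotient.idealrBE => /eqP.
Qed.

Lemma to_hquot_homog f d j : f \is d.-homog ->
  to_hquot (to_coord f) j = f.@[ncoord j] *: laurent_X K d.
Proof.
move=> fd; rewrite to_hquotE eval_hquotE (restr_line_homog _ fd).
by rewrite poly_laurentZ laurent_Xn.
Qed.

Lemma ncoord0 j : ncoord j ord0 = 1.
Proof. by rewrite /ncoord divff // hcoord0_neq0. Qed.

Lemma to_hquot_x0_poly a :
  to_hquot (x0_poly a) = diag_hquot (poly_laurent a).
Proof.
apply/ffunP => j; rewrite /x0_poly to_hquotE eval_hquotE [RHS]ffunE.
congr poly_laurent; elim/poly_ind: a => [|a c IH]; first by rewrite !rmorph0.
rewrite !rmorphD !rmorphM /= IH horner_algX horner_algC; congr (_ * _ + _).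
  rewrite (@restr_line_homog _ _ 1); last by rewrite dhomogX; apply/eqP/mdeg1.
  by rewrite mevalXU ncoord0 scale1r.
rewrite alg_mpolyC (@restr_line_homog _ _ 0); last first.
  by rewrite -alg_mpolyC rpredZ // dhomog1.
by rewrite mevalC expr0 alg_polyC.
Qed.

Lemma to_hquot_x0 :
  to_hquot (to_coord 'X_ord0) = diag_hquot (laurent_X K 1).
Proof.
apply/ffunP => j; rewrite (@to_hquot_homog _ 1); last first.
  by rewrite dhomogX; apply/eqP/mdeg1.
by rewrite mevalXU ncoord0 scale1r ffunE.
Qed.

Lemma separator j : exists (d : nat) (f : P), [/\ f \is d.-homog,
  f.@[ncoord j] != 0 & forall k, k != j -> f.@[ncoord k] = 0].
Proof.
have sep k : exists i, k != j -> ncoord j i != ncoord k i.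
  case: (eqVneq k j) => [_|kj]; first by exists ord0.
  have [eqjk|/forallPn [i ni]] := boolP [forall i, ncoord j i == ncoord k i];
    last by exists i.
  case/eqP: kj; apply: (@hcoord_distinct _ _ _ X).
  exists (hcoord X k ord0 / hcoord X j ord0) => i.
  have /eqP := forallP eqjk i; rewrite /ncoord => e.
  by rewrite mulrAC -mulrA e mulrC divfK // hcoord0_neq0.
have {}sep k : {i | k != j -> ncoord j i != ncoord k i}.
  exact: cid (sep k).
pose l k : P := 'X_(sval (sep k)) - ncoord k (sval (sep k)) *: 'X_ord0.
have lE k t : (l k).@[ncoord t] =
    ncoord t (sval (sep k)) - ncoord k (sval (sep k)).
  by rewrite mevalB mevalZ !mevalXU ncoord0 mulr1.
have lh k : l k \is 1.-homog.
  by rewrite rpredB ?rpredZ // dhomogX; apply/eqP/mdeg1.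
have [d hd] : exists d, \prod_(k | k != j) l k \is d.-homog.
  apply: (big_ind (fun g : P => exists d, g \is d.-homog)) => [|f g [d fd] [e ge]|k _]; last by exists 1%N.
    by exists 0%N; apply: dhomog1.
  by exists (d + e)%N; apply: dhomogM.
exists d, (\prod_(k | k != j) l k); split=> //.
- rewrite rmorph_prod; apply/prodf_neq0 => k kj.
  by rewrite /= lE subr_eq0 (svalP (sep k)).
- move=> k kj; rewrite rmorph_prod (bigD1 k) //= lE subrr mul0r //.
Qed.

Lemma hquot_localization q :
  exists (k : nat) (r : coord_ring), q * diag_hquot (laurent_X K k) = to_hquot r.
Proof.
have x0E k : diag_hquot (laurent_X K k%:Z) = to_hquot (x0_poly 'X^k).
  by rewrite to_hquot_x0_poly laurent_Xn.
have diagD (k l : nat) : diag_hquot (laurent_X K (k + l)%N) =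
    diag_hquot (laurent_X K k) * diag_hquot (laurent_X K l).
  by apply/ffunP => j; rewrite !ffunE PoszD laurent_XD.
pose S q := exists (k : nat) r, q * diag_hquot (laurent_X K k) = to_hquot r.
have qE : q = \sum_j [ffun t => if t == j then q j else 0].
  apply/ffunP => t; rewrite sum_ffunE (bigD1 t) //= ffunE eqxx.
  by rewrite big1 ?addr0 // => j jt; rewrite ffunE eq_sym (negbTE jt).
suff : S q by []; rewrite qE; apply: (big_ind S) => [|u v [k [r ur]] [l [w vw]]|j _].
- by exists 0%N, 0; rewrite mul0r rmorph0.
- exists (k + l)%N, (r * x0_poly 'X^l + w * x0_poly 'X^k).
  rewrite (rmorphD to_hquot) !(rmorphM to_hquot) /= -ur -vw -!x0E mulrDl; congr (_ + _).
    by rewrite diagD mulrA.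
  by rewrite addnC diagD mulrA.
- have [k [p qp]] := laurentP (q j); have [d [f [fd fj f0]]] := separator j.
  exists (k + d)%N, (x0_poly p * to_coord (f.@[ncoord j]^-1 *: f)).
  rewrite rmorphM /= to_hquot_x0_poly; apply/ffunP => t.
  rewrite [LHS]ffunE [RHS]ffunE (@to_hquot_homog _ d) ?rpredZ // mevalZ !ffunE.
  case: eqP => [->|/eqP tj]; last by rewrite (f0 t tj) mulr0 scale0r mulr0 mul0r.
  by rewrite mulVf // scale1r -qp PoszD laurent_XD mulrA.
Qed.

End Points.

(* Main.v *)
(* Evaluation at the normalised points identifies R_i with a subspace V_i of K^s;
   these subspaces increase with i, and r is the least index with V_r = K^s.
   In Q^h(R), the degree -r component of the complementary module is the
   orthogonal of V_(r-1).

   If i >= 2r then the different contains every w T^i: lift the idempotent e_j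
   to u_j in R_r and w_j e_j to y_j in R_(i-r); if g sigma is the base change
   of phi, then the j-th component of g is phi(u_j) T^-r, so that
   w T^i * g = sum_j phi(u_j) y_j lies in R.

   If the different contained every w T^(2r-1), take c <> 0 orthogonal to
   V_(r-1), so that g = c T^-r is in the complementary module. Then
   e_j T^(2r-1) * g lies in R, so the trace of g * (e_j T^(2r-1) * g), which is
   c_j^2 T^-1, is a polynomial; hence c_j = 0 for all j. *)

Require Import Defs.
From mathcomp Require Import all_boot all_order all_algebra.
From mathcomp Require Import boolp.
From mathcomp Require Import mpoly zify.

Set Implicit Arguments.
Unset Strict Implicit.
Unset Printing Implicit Defensive.

Import Order.TTheory GRing.Theory Num.Theory.
Local Open Scope ring_scope.

(** * Linear algebra: subspaces of K^s and graded modules embedded in K^s *)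

(** Choose [A] of maximal rank among the matrices whose row space lies in [W]. Adjoining a vector of
    [W] to [A] keeps the row space inside [W], so it cannot raise the rank. *)
Lemma row_subspace_mx (K : fieldType) (s : nat) (W : 'rV[K]_s -> Prop) :
  W 0 -> (forall a u v, W u -> W v -> W (a *: u + v)) ->
  exists A : 'M[K]_s, forall v, W v <-> (v <= A)%MS.
Proof.
move=> W0 WD.
pose S (A : 'M[K]_s) := forall v, (v <= A)%MS -> W v.
pose p d := `[< exists A, S A /\ \rank A = d >].
have p0 : exists d, p d.
  exists 0%N; apply/asboolP; exists 0; rewrite mxrank0; split=> // v.
  by rewrite submx0 => /eqP ->.
have pb d : p d -> (d <= s)%N by move=> /asboolP[A [_ <-]]; exact: rank_leq_row.
case: (ex_maxnP p0 pb) => d /asboolP [A [SA rA]] maxd.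
exists A => v; split=> [Wv|/SA //].
have SAv : S (A + v)%MS.
  move=> u /sub_addsmxP [[x y] /= ->].
  rewrite addrC [y]mx11_scalar mul_scalar_mx; apply: WD => //.
  by apply: SA; rewrite submxMl.
have lerk : (\rank (A + v)%MS <= \rank A)%N.
  by rewrite rA; apply: maxd; apply/asboolP; exists (A + v)%MS.
apply: submx_trans (addsmxSr A v) _.
by rewrite -(mxrank_leqif_sup (addsmxSl A v)) eqn_leq lerk mxrankS ?addsmxSl.
Qed.

Section GradedSubspaces.
Variables (K : fieldType) (V : lmodType K) (s : nat).

(* The hypotheses say that [E] is the graph of an isomorphism from the subspace
   [A] to a subspace of [K^s]. *)
Lemma has_dim_graph (A : V -> Prop) (E : V -> 'rV[K]_s -> Prop) :
  (forall v, A v <-> exists w, E v w) -> E 0 0 ->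
  (forall a u v x y, E u x -> E v y -> E (a *: u + v) (a *: x + y)) ->
  (forall v, E v 0 -> v = 0) -> (forall w, E 0 w -> w = 0) ->
  exists2 d, has_dim A d & d = s <-> forall w, exists v, E v w.
Proof.
move=> AE E0 ED Einj Efun.
have [B WB] : exists B : 'M[K]_s, forall w, (exists v, E v w) <-> (w <= B)%MS.
  apply: row_subspace_mx => [|a u v [x Ex] [y Ey]]; first by exists 0.
  by exists (a *: x + y); apply: ED.
have Esum (I : Type) (r : seq I) (c : I -> K) (b : I -> V) w :
    (forall i, E (b i) (w i)) ->
    E (\sum_(i <- r) c i *: b i) (\sum_(i <- r) c i *: w i).
  by move=> Eb; elim/big_rec2: _ => // i x y _ ?; apply: ED.
have Eeq v v' w : E v w -> E v' w -> v = v'.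
  move=> Ev Ev'; apply/eqP; rewrite -subr_eq0; apply/eqP/Einj.
  by rewrite -scaleN1r addrC -(addNr w) -scaleN1r; apply: ED.
exists (\rank B); last first.
  split=> [rB w|all].
    by apply/WB/submx_full; rewrite /row_full rB.
  apply/eqP; rewrite eqn_leq rank_leq_row /=.
  rewrite -[leqLHS](mxrank1 K); apply: mxrankS; apply/row_subP => i.
  exact/WB.
(* The basis of [A] is obtained by lifting a basis of the image of [E] row by row. *)
have rowE k : exists v, E v (row k (row_base B)).
  by apply/WB; rewrite (submx_trans (row_sub _ _)) // eq_row_base.
pose b k := projT1 (cid (rowE k)); pose bE k : E (b k) _ := projT2 (cid (rowE k)).
exists b; split=> [c c0 k|v].
  have := Esum _ (index_enum _) c b _ bE; rewrite c0 => /Efun.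
  rewrite (_ : \sum_k _ = (\row_k c k) *m row_base B); last first.
    by rewrite mulmx_sum_row; apply: eq_bigr => l _; rewrite mxE.
  move/eqP; rewrite -(mul0mx _ (row_base B)) => /eqP /(row_free_inj (row_base_free B)).
  by move=> /rowP /(_ k); rewrite !mxE.
rewrite AE; split=> [[w Ew]|[c ->]]; last by eexists; apply: Esum bE.
have: (w <= row_base B)%MS by rewrite eq_row_base; apply/WB; exists v.
case/submxP => D wD; exists (fun k => D 0 k); apply: Eeq Ew _.
rewrite wD mulmx_sum_row; exact: Esum bE.
Qed.

(** Each M_i has dimension at most s, with equality exactly when [E i] is onto, so the Hilbert
    polynomial is the constant s. Failure at r - 1 alone gives minimality: a candidate index below r
    would force the dimension s at r - 1. *)
Lemma regularity_index_graph (M : int -> V -> Prop)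
    (E : int -> V -> 'rV[K]_s -> Prop) (r : int) :
  (forall i v, M i v <-> exists w, E i v w) -> (forall i, E i 0 0) ->
  (forall i a u v x y, E i u x -> E i v y -> E i (a *: u + v) (a *: x + y)) ->
  (forall i v, E i v 0 -> v = 0) -> (forall i w, E i 0 w -> w = 0) ->
  (forall i, r <= i -> forall w, exists v, E i v w) ->
  ~ (forall w, exists v, E (r - 1) v w) ->
  is_hilbert_polynomial M s%:R%:P /\ is_regularity_index M r.
Proof.
move=> ME E0 ED Einj Efun full nfull.
have /choice [HF dHF] i : exists d,
    has_dim (M i) d /\ (d = s <-> forall w, exists v, E i v w).
  have [d dM dE] := has_dim_graph (ME i) (E0 i) (ED i) (Einj i) (Efun i).
  by exists d.
have HFM : is_hilbert_function M HF by move=> i; have [] := dHF i.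
have HFs i : (HF i)%:R = (s%:R%:P : {poly rat}).[i%:~R] <->
    forall w, exists v, E i v w.
  rewrite hornerC -(dHF i).2; split=> [/eqP|-> //].
  by rewrite eqr_nat => /eqP.
have HPM : is_hilbert_polynomial M s%:R%:P.
  by exists HF; split=> //; exists r => i /full /HFs.
split=> //; exists HF, s%:R%:P; split=> // [j /full /HFs //|i iP].
rewrite leNgt; apply/negP => ir; apply/nfull/HFs/iP.
by rewrite lerBrDr lezD1.
Qed.

End GradedSubspaces.

(** * Homogeneous elements of Q^h(R) as rows of coefficients *)

Section Points.
Variables (K : fieldType) (n s : nat) (X : point_set K n s).

Local Notation Xn := (laurent_X K).

Definition hquot_row (i : int) (w : 'rV[K]_s) : hquot K s :=
  [ffun j => w 0 j *: Xn i].

Lemma hquot_row_linear i a u v :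
  hquot_row i (a *: u + v) = a *: hquot_row i u + hquot_row i v.
Proof. by apply/ffunP => j; rewrite !ffunE !mxE scalerDl scalerA. Qed.

Lemma hquot_row0 i : hquot_row i 0 = 0.
Proof. by apply/ffunP => j; rewrite !ffunE mxE scale0r. Qed.

Lemma hquot_rowM i k u v : hquot_row i u * hquot_row k v =
  hquot_row (i + k) (\row_j (u 0 j * v 0 j)).
Proof.
apply/ffunP => j; rewrite !ffunE mxE laurent_XD.
by rewrite -scalerAl -scalerAr scalerA.
Qed.

Lemma poly_laurent_negX (p : {poly K}) c :
  poly_laurent p = c *: Xn (-1) -> c = 0.
Proof.
move=> /(congr1 ( *%R^~ (Xn 1))); rewrite -scalerAl -laurent_XD laurent_X0.
rewrite (laurent_Xn K 1) -rmorphM => e.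
have {}e : p * 'X^1 = c%:P.
  by apply: poly_laurent_inj; rewrite e -alg_polyC poly_laurentZ rmorph1.
by have := congr1 (fun q : {poly K} => q`_0) e; rewrite coefMX coefC.
Qed.

Lemma coef_poly_laurent (p : {poly K}) c i (k : nat) :
  poly_laurent p = c *: Xn i -> p`_k != 0 -> k%:Z = i.
Proof.
(* As i + |i| >= 0, multiplying by T^|i| turns the equation into one between polynomials. *)
pose q := `|i|%N; have [t tE] : exists t : nat, i + q%:Z = t%:Z.
  by exists `|(i + q%:Z)%R|%N; rewrite /q; lia.
move=> /(congr1 ( *%R^~ (Xn q))); rewrite -scalerAl -laurent_XD tE !laurent_Xn.
rewrite -rmorphM -poly_laurentZ => /poly_laurent_inj e.
have := congr1 (fun p : {poly K} => p`_(k + q)) e.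
rewrite coefMXn ltnNge leq_addl addnK coefZ coefXn /= => ->.
by case: (_ =P t) => [|_]; [lia | rewrite mulr0 eqxx].
Qed.

Lemma laurent_scaleX_eq0 i (c : K) : c *: Xn i = 0 -> c = 0.
Proof.
(* Multiplication by T^(-1-i) moves the equation to degree -1. *)
move=> c0; apply: (@poly_laurent_negX 0); rewrite rmorph0.
by rewrite -[-1](addrNK i) addrC laurent_XD scalerAl c0 mul0r.
Qed.

Lemma hquot_row_eq0 i w : hquot_row i w = 0 -> w = 0.
Proof.
move=> w0; apply/rowP => j; rewrite mxE; apply: (@laurent_scaleX_eq0 i).
by move/ffunP: w0 => /(_ j); rewrite !ffunE.
Qed.

Lemma hquot_degE i q : hquot_deg i q <-> exists w, q = hquot_row i w.
Proof.
split=> [[c qc]|[w ->]]; last by exists (fun j => w 0 j) => j; rewrite ffunE.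
by exists (\row_j c j); apply/ffunP => j; rewrite !ffunE mxE.
Qed.

(** * The components R_i as subspaces of K^s *)

Lemma to_hquotZ c (x : coord_ring X) : to_hquot (c *: x) = c *: to_hquot x.
Proof.
apply/ffunP => j; rewrite rmorphM /= to_hquotE [LHS]ffunE [RHS]ffunE; congr (_ * _).
by rewrite ffunE mmapC; exact: mulr1.
Qed.

Lemma coord_deg_linear i a (x y : coord_ring X) :
  coord_deg i x -> coord_deg i y -> coord_deg i (a *: x + y).
Proof.
move=> [f [fi ->]] [g [gi ->]]; exists (a *: f + g); split=> [m|].
  by move/msuppD_le; rewrite mem_cat => /orP [/msuppZ_le /fi|/gi].
by rewrite rmorphD -mul_mpolyC rmorphM.
Qed.

Lemma coord_deg_nat (d : nat) (x : coord_ring X) :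
  coord_deg d x <-> exists2 f, f \is d.-homog & x = to_coord X f.
Proof.
split=> [[f [fd ->]]|[f /dhomogP fd ->]].
  by exists f => //; apply/dhomogP => m /fd [].
by exists f; split=> // m /fd ->.
Qed.

Lemma coord_deg_lt0 (i : int) (x : coord_ring X) :
  i < 0 -> coord_deg i x -> x = 0.
Proof.
move=> i0 [f [fi ->]]; rewrite (_ : f = 0) ?rmorph0 //.
apply/eqP; rewrite -msupp_eq0; case E: (msupp f) => [//|m l].
by move: (fi m); rewrite E mem_head => /(_ isT) mi; rewrite -mi in i0.
Qed.

Lemma to_hquot_homog_row (d : nat) f : f \is d.-homog ->
  to_hquot (to_coord X f) = hquot_row d (\row_j f.@[ncoord X j]).
Proof.
by move=> fd; apply/ffunP => j; rewrite (to_hquot_homog _ _ fd) !ffunE mxE.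
Qed.

Lemma to_hquot_coord_deg i (x : coord_ring X) : coord_deg i x ->
  exists w, to_hquot x = hquot_row i w.
Proof.
case: i => [d|d] => [/coord_deg_nat [f fd ->]|/coord_deg_lt0 ->] //.
  by eexists; apply: to_hquot_homog_row.
by exists 0; rewrite rmorph0 hquot_row0.
Qed.

Definition coord_graph i (x : coord_ring X) w :=
  coord_deg i x /\ to_hquot x = hquot_row i w.

(* R_i maps onto K^s T^i; this fails for [i < 0] because [s > 0]. *)
Definition coord_full i := forall w, exists x, coord_graph i x w.

(** Multiplication by a power of x_0 raises the degree without changing the values, because x_0 is 1
    at the normalised points. *)
Lemma coord_graph_le (d e : nat) x w : (d <= e)%N ->
  coord_graph d x w -> exists y, coord_graph e y w.
Proof.
move=> de [/coord_deg_nat [f fd ->] fw]; exists (to_coord X (f * 'X_ord0 ^+ (e - d))).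
have X1 : ('X_ord0 : {mpoly K[n.+1]}) \is 1.-homog by rewrite dhomogX; apply/eqP/mdeg1.
have fe : f * 'X_ord0 ^+ (e - d) \is e.-homog.
  have := dhomogM fd (dhomogMn (e - d) X1).
  by rewrite mul1n subnKC.
split; first by apply/coord_deg_nat; eexists; first exact: fe.
rewrite (to_hquot_homog_row fe); congr hquot_row; apply/rowP => j.
rewrite !mxE mevalM rmorphXn /= mevalXU ncoord0 expr1n mulr1.
apply/eqP; rewrite -subr_eq0; apply/eqP/(@laurent_scaleX_eq0 d).
move/ffunP: fw => /(_ j); rewrite (to_hquot_homog _ _ fd) ffunE scalerBl => ->.
by rewrite subrr.
Qed.

Lemma coord_full_ge0 i : coord_full i -> 0 <= i.
Proof.
move=> full; rewrite leNgt; apply/negP => i0.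
have [x [/(coord_deg_lt0 i0) ->]] := full (const_mx 1).
rewrite rmorph0 => /esym /hquot_row_eq0 /rowP /(_ (Ordinal (point_set_nonempty X))).
by rewrite !mxE => /eqP; rewrite oner_eq0.
Qed.

Lemma coord_full_le i k : i <= k -> coord_full i -> coord_full k.
Proof.
move=> ik fi w; have := coord_full_ge0 fi.
case: i ik fi => // d dk fd _; case: k dk => // e de.
by have [x /(coord_graph_le de)] := fd w.
Qed.

Lemma coord_graph0 i : coord_graph i 0 0.
Proof.
split; last by rewrite rmorph0 hquot_row0.
by exists 0; split; rewrite ?rmorph0 // => m; rewrite msupp0.
Qed.

Lemma coord_graph_linear i a x y u v :
  coord_graph i x u -> coord_graph i y v -> coord_graph i (a *: x + y) (a *: u + v).
Proof.
move=> [xi xu] [yi yv]; split; first exact: coord_deg_linear.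
by rewrite hquot_row_linear -xu -yv -to_hquotZ rmorphD.
Qed.

(** A separator of p_j, divided by its value there, yields the j-th unit vector in some degree; the
    maximum of these degrees serves all j. *)
Lemma coord_full_exists : exists d : nat, coord_full d.
Proof.
have /choice [d dE] j : exists d : nat, exists x, coord_graph d x (delta_mx 0 j).
  have [d [f [fd fj f0]]] := separator X j.
  exists d, (to_coord X (f.@[ncoord X j]^-1 *: f)); split.
    by apply/coord_deg_nat; exists (f.@[ncoord X j]^-1 *: f); rewrite ?rpredZ.
  rewrite (to_hquot_homog_row (rpredZ _ fd)); congr hquot_row; apply/rowP => t.
  rewrite !mxE mevalZ /=; case: eqVneq => [->|/f0 ->]; last exact: mulr0.
  by rewrite mulVf.
exists (\max_j d j)%N => w; rewrite [w]row_sum_delta.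
apply: (big_rec (fun v => exists x, coord_graph _ x v)) => [|j v _ [x xv]].
  by exists 0; apply: coord_graph0.
have [y /(coord_graph_le (leq_bigmax j)) [z zj]] := dE j.
by exists (w 0 j *: z + x); apply: coord_graph_linear.
Qed.

Lemma regularity_coord (r : int) :
  (forall i, r <= i -> coord_full i) -> ~ coord_full (r - 1) ->
  is_regularity_index (@coord_deg K n s X) r.
Proof.
move=> full nfull; have [] // := @regularity_index_graph K _ s
  (@coord_deg K n s X) coord_graph r.
- move=> i x; split=> [xi|[w []//]].
  by have [w xw] := to_hquot_coord_deg xi; exists w.
- exact: coord_graph0.
- by move=> *; apply: coord_graph_linear.
- by move=> i v [_]; rewrite hquot_row0 -(rmorph0 (@to_hquot K n s X)) => /to_hquot_inj.
- by move=> i w [_]; rewrite rmorph0 => /esym /hquot_row_eq0.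
Qed.

(** * The different in degrees at least 2r *)

Lemma different_linear a u v :
  different X u -> different X v -> different X (a *: u + v).
Proof.
move=> Du Dv g Cg; have [x ux] := Du g Cg; have [y vy] := Dv g Cg.
exists (a *: x + y); rewrite rmorphD /= to_hquotZ -ux -vy mulrDl.
by congr (_ + _); apply/ffunP => j; rewrite !ffunE scalerAl.
Qed.

Lemma different_full (r i : int) w : coord_full r -> coord_full (i - r) ->
  different X (hquot_row i w).
Proof.
move=> fr fir g [phi _ [_ phiE]].
pose e (j : 'I_s) : 'rV[K]_s := delta_mx 0 j.
have /choice [u uE] j : exists x, coord_graph r x (e j) by apply: fr.
have /choice [y yE] j : exists x, coord_graph (i - r) x (w 0 j *: e j) by apply: fir.
(* Each phi(u_j) is a polynomial in x_0, so this sum stays in R even if g has negative degrees. *)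
exists (\sum_j x0_poly X (phi (u j)) * y j); rewrite rmorph_sum.
apply/ffunP => t; rewrite sum_ffunE (bigD1 t) //= big1 ?addr0 => [|j jt]; last first.
  rewrite rmorphM /= to_hquot_x0_poly (yE j).2 !ffunE !mxE.
  by rewrite eq_sym (negbTE jt) mulr0 scale0r mulr0.
rewrite rmorphM /= to_hquot_x0_poly (yE t).2 !ffunE !mxE !eqxx mulr1.
(* Since u_t is supported at p_t, the trace of g u_t is its t-th component g_t T^r, which is
   therefore phi(u_t). *)
have := phiE (u t) 1.
rewrite (uE t).2 /trace_hquot mulr1 => <-.
rewrite (bigD1 t) //= big1 ?addr0 => [|j jt]; last first.
  by rewrite !ffunE !mxE (negbTE jt) andbF scale0r mul0r mulr0.
rewrite !ffunE !mxE !eqxx scale1r mulr1 -!scalerAr -!scalerAl.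
by rewrite -mulrA -laurent_XD subrKC mulrC.
Qed.

(** * Elements of the complementary module and failure in degree 2r - 1 *)

(** The image of R_r is the row space of a singular square matrix [A], and a nonzero vector of the
    left kernel of its transpose is orthogonal to every row. *)
Lemma row_orthogonal (r : int) : ~ coord_full r ->
  exists2 c : 'rV[K]_s, c != 0 &
    forall x w, coord_graph r x w -> \sum_j c 0 j * w 0 j = 0.
Proof.
move=> nfull.
have [|a u v [x xu] [y yv]|A AE] :=
    @row_subspace_mx K s (fun w => exists x, coord_graph r x w).
- by exists 0; apply: coord_graph0.
- by exists (a *: x + y); apply: coord_graph_linear.
have /rowV0Pn [c cA c0] : kermx A^T != 0.
  rewrite kermx_eq0; apply/negP; rewrite /row_free mxrank_tr => rA.
  by apply: nfull => w; apply/AE/submx_full.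
exists c => // x w xw.
have /submxP [D ->] : (w <= A)%MS by apply/AE; exists x.
have /sub_kermxP cA0 := cA.
transitivity ((c *m (D *m A)^T) 0 0).
  by rewrite mxE; apply: eq_bigr => j _; rewrite [(_^T) _ _]mxE.
by rewrite trmx_mul mulmxA cA0 mul0mx mxE.
Qed.

(** The candidate is phi(x) = trace(g x). For x = f it equals T^(-r) times G, the sum of the c_j f(T
    p_j), whose coefficients below degree r vanish by orthogonality; hence it is a polynomial. *)
Lemma complementary_row (r : nat) (c : 'rV[K]_s) :
  (forall x w, coord_graph (r%:Z - 1) x w -> \sum_j c 0 j * w 0 j = 0) ->
  complementary X (hquot_row (- r%:Z) c).
Proof.
move=> c0; set g := hquot_row _ c.
have /choice [phi phiE] (x : coord_ring X) : exists p : {poly K},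
    poly_laurent p = trace_hquot (g * to_hquot x).
  have [f ->] := to_coord_surj x.
  pose G := \sum_j c 0 j *: restr_line (ncoord X j) f.
  have G0 : take_poly r G = 0.
    apply/polyP => m; rewrite coef_take_poly coef0; case: ltnP => // mr.
    rewrite coef_sum; under eq_bigr do rewrite coefZ coef_restr_line.
    have fm := pihomogP mdeg m f.
    have fmE : coord_graph m (to_coord X (pihomog mdeg m f))
        (\row_j (pihomog mdeg m f).@[ncoord X j]).
      split; last exact: to_hquot_homog_row.
      by apply/coord_deg_nat; exists (pihomog mdeg m f).
    (* Here m < r forces r > 0, so r - 1 is a natural number and the values of the m-th component
       also come from R_(r-1). *)
    have [|y yE] := @coord_graph_le m r.-1 _ _ _ fmE; first by lia.
    have rE : r%:Z - 1 = r.-1%:Z by lia.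
    rewrite rE in c0; rewrite -[RHS](c0 _ _ yE).
    by apply: eq_bigr => j _; rewrite mxE.
  exists (drop_poly r G); have := poly_take_drop r G; rewrite G0 add0r => GE.
  transitivity (poly_laurent G * Xn (- r%:Z)).
    by rewrite -[in RHS]GE rmorphM /= -laurent_Xn -mulrA -laurent_XD subrr laurent_X0 mulr1.
  rewrite rmorph_sum mulr_suml; apply: eq_bigr => j _.
  by rewrite /= to_hquotE [RHS]ffunE eval_hquotE ffunE poly_laurentZ -!scalerAl mulrC.
have traceD (u v : hquot K s) : trace_hquot (u + v) = trace_hquot u + trace_hquot v.
  by rewrite -big_split; apply: eq_bigr => j _; rewrite ffunE.
have diagC (u : hquot K s) l : diag_hquot s l * u = u * diag_hquot s l.
  by apply/ffunP => j; rewrite !ffunE mulrC.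
have traceM (u : hquot K s) l : trace_hquot (u * diag_hquot s l) = trace_hquot u * l.
  by rewrite mulr_suml; apply: eq_bigr => j _; rewrite !ffunE.
exists phi; last first.
  by split=> [q q'|x l]; [rewrite mulrDr traceD | rewrite mulrA traceM phiE].
(* A single summand suffices: phi is itself homogeneous of degree -r. *)
exists 1%N, (fun=> - r%:Z), (fun=> phi); split=> [_ a x t|_ i x xi k|x]; last first.
- by rewrite big_ord1.
- have [w xw] := to_hquot_coord_deg xi.
  apply: (@coef_poly_laurent _ (\sum_j c 0 j * w 0 j)).
  rewrite phiE xw hquot_rowM addrC scaler_suml.
  by apply: eq_bigr => j _; rewrite ffunE mxE.
- apply: poly_laurent_inj; rewrite rmorphD rmorphM /= !phiE.
  rewrite rmorphD rmorphM /= to_hquot_x0_poly mulrDr traceD.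
  by rewrite diagC mulrA traceM mulrC.
Qed.

Lemma different_not_full (r : nat) : ~ coord_full (r%:Z - 1) ->
  ~ (forall w, different X (hquot_row (2 * r%:Z - 1) w)).
Proof.
move=> /row_orthogonal [c c0 /complementary_row Cg] all.
case/negP: c0; apply/eqP/rowP => j; rewrite mxE.
have [x xE] := all (delta_mx 0 j) _ Cg.
(* Base change at x with l = 1 makes the trace of g x the polynomial phi(x). *)
have [phi _ [_ /(_ x 1)]] := Cg.
have -> : diag_hquot s (1 : laurent K) = 1 by apply/ffunP => t; rewrite !ffunE.
rewrite !mulr1 -xE /trace_hquot !hquot_rowM (bigD1 j) //= big1 ?addr0 => [|t tj]; last first.
  by rewrite ffunE !mxE (negbTE tj) andbF mul0r mulr0 scale0r.
(* The degrees add up to -r + (2r - 1) - r = -1. *)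
rewrite ffunE !mxE !eqxx mul1r (_ : _ + _ = -1) => [/esym/poly_laurent_negX/eqP|].
  by rewrite mulf_eq0 orbb => /eqP.
lia.
Qed.

End Points.

Theorem corollary3p6 (K : fieldType) (n s : nat) (X : point_set K n s) :
  is_hilbert_polynomial (different_deg X) (s%:R%:P) /\
  exists rX : int, is_regularity_index (@coord_deg K n s X) rX /\
    is_regularity_index (different_deg X) (2 * rX).
Proof.
have pex : exists d : nat, `[< coord_full X d >].
  by have [d fd] := coord_full_exists X; exists d; apply/asboolP.
case: (ex_minnP pex) => r /asboolP fr minr.
have full i : r%:Z <= i -> coord_full X i by move=> ri; apply: coord_full_le ri fr.
have nfull : ~ coord_full X (r%:Z - 1).
  (* For r = 0 the index is -1, excluded because negative components of R vanish; otherwise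
     minimality of r applies. *)
  case: r {fr full} minr => [|r] minr f; first by have := coord_full_ge0 f.
  have /minr : `[< coord_full X r >].
    by apply/asboolP; move: f; rewrite -addn1 PoszD addrK.
  by rewrite ltnn.
have [HP ri] : is_hilbert_polynomial (different_deg X) (s%:R%:P) /\
    is_regularity_index (different_deg X) (2 * r%:Z).
  apply: (@regularity_index_graph K _ s _
    (fun i v w => different_deg X i v /\ v = hquot_row i w)).
  - move=> i v; split=> [Dv|[w []//]].
    by have [_ /hquot_degE [w]] := Dv; exists w.
  - move=> i; rewrite hquot_row0; split=> //; split.
      by move=> g _; exists 0; rewrite mul0r rmorph0.
    by apply/hquot_degE; exists 0; rewrite hquot_row0.
  - move=> i a u v x y [[Du _] ux] [[Dv _] vy]; rewrite hquot_row_linear -ux -vy.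
    split=> //; split; first exact: different_linear.
    by apply/hquot_degE; exists (a *: x + y); rewrite hquot_row_linear ux vy.
  - by move=> i v [_ ->]; rewrite hquot_row0.
  - by move=> i w [_ /esym /hquot_row_eq0].
  - move=> i ri w; exists (hquot_row i w); split=> //; split.
      (* The bound 2r <= i gives r <= i - r, so both R_r and R_(i-r) are full. *)
      by apply: (@different_full _ _ _ _ r) => //; apply: full; lia.
    by apply/hquot_degE; exists w.
  - move=> all; apply: (different_not_full nfull) => w.
    by have [v [[Dv _] vE]] := all w; rewrite -vE.
split=> //; exists r; split=> //.
exact: regularity_coord.
Qed.
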